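(* Let $X\subset\mathcal L$, $f\in X$, $n\ge1$, and let $Y_i=f\left(\frac{i-1}{n}\right)+\epsilon_i$, $i=1,\dots,n$, where $\epsilon_1,\dots,\epsilon_n$ are independent real random variables with mean zero such that for some $\kappa>0$, $v>0$ and all integers $m\ge2$ one has $\mathbb E|\epsilon_i|^m\le v\,m!\,\kappa^{m-2}/2$ for all $i$. Let $\epsilon>0$ and $k\in\mathbb N_0$, and suppose that $f^{(n)}\in X_k^{(n)}$ and $s_{k-1}(f^{(n)})\ge\epsilon$. Then $$\mathbb P\left(k_{\epsilon/2}(Y^{(n)})=k\right)\ge 1-2\exp\left(-\frac{\epsilon^2n}{8v+4\kappa\epsilon}\right).$$
   Context: $\mathcal L^\infty$ is the space of Lebesgue-measurable essentially bounded functions $[0,1]\to\mathbb R$ (genuine functions, not equivalence classes). With $t^-(\delta)=\max(0,t-\delta)$, $t^+(\delta)=\min(1,t+\delta)$, let $\mathcal L$ be the set of $f\in\mathcal L^\infty$ with $f(t)=\lim_{\eta\to0}\inf_{0<\delta<\eta}\frac{1}{t^+(\delta)-t^-(\delta)}\int_{t^-(\delta)}^{t^+(\delta)}f(s)\,ds$ for all $t\in[0,1]$ (each a.e.-class in $\mathcal L^\infty$ has exactly one representative in $\mathcal L$). The Kolmogorov distance is $d_K(f,g)=\sup_{x\in[0,1]}\left|\int_0^x (f(s)-g(s))\,ds\right|$. Number of modes: for $g:[0,1]\to\mathbb R$ and a partition $P$: $0=t_0<\dots<t_{N}=1$, let $M(g,P)$ be the number of indices $0<i<N$ with $\max(g(t_{i-1}),g(t_{i+1}))<g(t_i)$,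 and let $M(g)=\sup_P M(g,P)$ over all finite partitions. For $n\ge1$ let $PC_n$ be the set of $g\in\mathcal L$ that are constant on each open interval $\left(\frac{i-1}{n},\frac in\right)$, $i=1,\dots,n$. Let $X^{(n)}_j=\{g\in PC_n: M(g)\le j\}$, and for $g\in PC_n$ let $s_j(g)=\inf_{h\in X_j^{(n)}}d_K(g,h)$, $j\in\mathbb N_0$, and $s_{-1}(g)=\infty$. Let $f^{(n)}\in PC_n$ be the function with value $f\left(\frac{i-1}{n}\right)$ on $\left(\frac{i-1}{n},\frac in\right)$, and $Y^{(n)}\in PC_n$ the (random) function with value $Y_i$ on $\left(\frac{i-1}{n},\frac in\right)$, $i=1,\dots,n$. For $\eta>0$ and $g\in PC_n$: $k_\eta(g)=\max\{j\in\mathbb N_0: s_{j-1}(g)\ge\eta\}$. *)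

(* Defs.v *)
From HB Require Import structures.
From mathcomp Require Import all_boot all_order all_algebra.
From mathcomp Require Import all_classical all_reals all_analysis.
From mathcomp Require Import measurable_realfun ring lra zify.

Set Implicit Arguments.
Unset Strict Implicit.
Unset Printing Implicit Defensive.

Import Order.TTheory GRing.Theory Num.Theory.
Import numFieldNormedType.Exports.

Local Open Scope classical_set_scope.
Local Open Scope ring_scope.

(* A function [0,1] -> R is represented by a total function R -> R; every
   notion below only depends on its values on [0,1]. *)

Notation leb := completed_lebesgue_measure.

(* R with the sigma-algebra of Lebesgue (not just Borel) measurable sets *)
Notation lebesgueType R := (caratheodory_type (wlength (@idfun R))^*%mu).

Section Defs.
Variable R : realType.
Implicit Types (f g h : R -> R) (t x delta eta : R) (n : nat).

Definition Linfty : set (R -> R) := [set f : R -> R |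
  measurable_fun (`[0, 1]%classic : set (lebesgueType R)) f /\
  exists M : R, \forall t \ae leb, (t : R) \in `[0, 1] -> `|f t| <= M].

Definition tminus t delta : R := Num.max 0 (t - delta).
Definition tplus t delta : R := Num.min 1 (t + delta).

Definition local_avg f t delta : R :=
  (tplus t delta - tminus t delta)^-1 *
  \int[leb]_(s in `[tminus t delta, tplus t delta]) f s.

Definition calL : set (R -> R) := [set f | Linfty f /\
  forall t, t \in `[0, 1] ->
    ereal_inf [set (local_avg f t delta)%:E | delta in `]0, eta[]
      @[eta --> 0^'+] --> (f t)%:E].

Definition dK f g : \bar R :=
  ereal_sup [set `|\int[leb]_(s in `[0, x]) (f s - g s)|%:E | x in `[0, 1]].

(* only the values t 0, ..., t N are relevant *)
Definition is_partition (N : nat) (t : nat -> R) : Prop :=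
  [/\ t 0 = 0, t N = 1 & forall i, (i < N)%N -> t i < t i.+1].

Definition modes_at g (N : nat) (t : nat -> R) : nat :=
  (\sum_(1 <= i < N) (Num.max (g (t i.-1)) (g (t i.+1)) < g (t i))%R)%N.

Definition modes g : \bar R :=
  ereal_sup [set y | exists N (t : nat -> R),
    is_partition N t /\ y = (modes_at g N t)%:R%:E].

Definition PC n : set (R -> R) := [set g | calL g /\
  forall i, (i < n)%N -> exists c, forall t,
    i%:R / n%:R < t < i.+1%:R / n%:R -> g t = c].

Definition modalX n (j : nat) : set (R -> R) :=
  [set g | PC n g /\ (modes g <= j%:R%:E)%E].

(* s_{-1} = +oo; no other negative index is ever used *)
Definition s_ n (j : int) g : \bar R :=
  match j with
  | Posz j' => ereal_inf [set dK g h | h in modalX n j']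
  | Negz _ => +oo%E
  end.

Definition kset n eta g : set nat :=
  [set j | (eta%:E <= s_ n (j%:Z - 1) g)%E].

(* The maximum of [kset n eta g]. The default value is irrelevant: the maximum
   exists for eta > 0 and g in PC_n, see [k_etaP]. *)
Definition k_ n eta g : nat :=
  xget 0%N (kset n eta g `&` ubound (kset n eta g)).

Definition cell n (i : 'I_n) t : bool := i%:R / n%:R <= t <= i.+1%:R / n%:R.

(* The element of PC_n with value y i on the i-th open cell. Membership in
   calL forces the value at an interior breakpoint to be the mean of the two
   neighbouring values, and that at 0 and 1 to be the adjacent value, i.e. the
   mean of y over the closed cells containing t; see [stepE], [step_PC]. *)
Definition step n (y : 'I_n -> R) : R -> R := fun t =>
  (\sum_(i < n | cell i t) y i) / (\sum_(i < n | cell i t) 1).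

Definition mutually_independent d (T : measurableType d) (P : probability T R)
    (I : finType) (X : I -> {RV P >-> R}) : Prop :=
  forall (J : {set I}) (B : I -> set R), (forall i, measurable (B i)) ->
    P (\bigcap_(i in [set` J]) (X i @^-1` B i)) =
    (\prod_(i in J) P (X i @^-1` B i))%E.

Lemma cell_uniq n (i j : 'I_n) t : cell i t -> cell j t ->
  (i = 0%N :> nat \/ i%:R / n%:R < t) ->
  (i.+1 = n :> nat \/ t < i.+1%:R / n%:R) -> j = i.
Proof.
move=> /andP[_ _] /andP[jt tj] Hl Hr; apply/val_inj => /=.
have n0 : 0 < n%:R^-1 :> R by rewrite invr_gt0 ltr0n (leq_ltn_trans _ (ltn_ord i)).
apply/eqP; rewrite eqn_leq; apply/andP; split.
  case: Hr => [Hr|/(le_lt_trans jt)]; first by rewrite -ltnS Hr.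
  by rewrite ltr_pM2r// ltr_nat ltnS.
case: Hl => [->//|/lt_le_trans/(_ tj)].
by rewrite ltr_pM2r// ltr_nat ltnS.
Qed.

Lemma step_uniq n (y : 'I_n -> R) (i : 'I_n) t : cell i t ->
  (i = 0%N :> nat \/ i%:R / n%:R < t) ->
  (i.+1 = n :> nat \/ t < i.+1%:R / n%:R) -> step y t = y i.
Proof.
move=> it Hl Hr.
have E : (fun j => cell j t) =1 pred1 i.
  move=> j /=; apply/idP/eqP => [jt|->//]; exact: (cell_uniq it).
by rewrite /step !(eq_bigl _ _ E) !big_pred1_eq divr1.
Qed.

Lemma stepE n (y : 'I_n -> R) (i : 'I_n) t :
  i%:R / n%:R < t < i.+1%:R / n%:R -> step y t = y i.
Proof.
by move=> /andP[lt rt]; apply: step_uniq; [rewrite /cell !ltW|right|right].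
Qed.

Lemma lebesgue_mitv (i : interval R) :
  measurable ([set` i] : set (lebesgueType R)).
Proof. exact: sub_caratheodory (measurable_itv i). Qed.

Lemma measurable_fun_leb_cst (i : interval R) f c :
  (forall s, s \in i -> f s = c) ->
  measurable_fun ([set` i] : set (lebesgueType R)) f.
Proof.
move=> fc; apply: (eq_measurable_fun (cst c)) => //.
by move=> s /set_mem/= si; rewrite fc.
Qed.

Lemma integral_leb_cst (i : interval R) f c :
  (forall s, s \in i -> f s = c) ->
  (\int[leb]_(s in [set` i]) (f s)%:E = c%:E * lebesgue_measure [set` i])%E.
Proof.
move=> fc; transitivity (\int[leb]_(s in [set` i]) (cst c%:E s))%E.
  by apply: eq_integral => s /set_mem/= si; rewrite fc.
by rewrite integral_cst//; exact: lebesgue_mitv.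
Qed.

Lemma local_avg_cst f t delta c : t \in `[0, 1] -> 0 < delta ->
  (forall s, s \in `[tminus t delta, tplus t delta] -> f s = c) ->
  local_avg f t delta = c.
Proof.
rewrite in_itv/= => /andP[t0 t1] d0 fc.
have lt : tminus t delta < tplus t delta.
  by rewrite /tminus /tplus gt_max !lt_min; apply/andP; split; apply/andP; split; lra.
rewrite /local_avg /Rintegral (integral_leb_cst fc) lebesgue_measure_itv/= lte_fin lt.
by rewrite -EFinB -EFinM/= mulrC mulfK// subr_eq0 gt_eqF.
Qed.

Lemma local_avg_jump f t delta a b :
  0 < delta -> 0 <= t - delta -> t + delta <= 1 ->
  (forall s, s \in `[t - delta, t[ -> f s = a) ->
  (forall s, s \in `]t, t + delta] -> f s = b) ->
  local_avg f t delta = (a + b) / 2.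
Proof.
move=> d0 t0 t1 fa fb.
have -> : local_avg f t delta = ((t + delta) - (t - delta))^-1 *
    \int[leb]_(s in `[t - delta, t + delta]) f s.
  by rewrite /local_avg /tminus /tplus max_r// min_r.
have E1 : `[t - delta, t + delta]%classic =
    `[t - delta, t[%classic `|` `[t, t + delta]%classic.
  by rewrite -itv_bndbnd_setU ?bnd_simp//; lra.
have E2 : `[t, t + delta]%classic =
    `[t, t]%classic `|` `]t, t + delta]%classic.
  by rewrite -itv_bndbnd_setU ?bnd_simp//; lra.
have ft : forall s, s \in `[t, t] -> f s = f t.
  by move=> s; rewrite in_itv/= -eq_le => /eqP->.
have m1 := measurable_fun_leb_cst fa.
have m2 := measurable_fun_leb_cst fb.
have m3 := measurable_fun_leb_cst ft.
have mU : measurable_fun (`[t, t + delta]%classic : set (lebesgueType R)) f.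
  by rewrite E2; apply/measurable_funU => //; exact: lebesgue_mitv.
rewrite /Rintegral E1 integral_setU//=; last 4 first.
- exact: lebesgue_mitv.
- exact: lebesgue_mitv.
- apply/measurable_EFinP; apply/measurable_funU => //; exact: lebesgue_mitv.
- apply/disj_setPS => s [/=]; rewrite !in_itv/= => /andP[_ st] /andP[ts _].
  by move: (le_lt_trans ts st); rewrite ltxx.
rewrite E2 integral_setU//=; last 4 first.
- exact: lebesgue_mitv.
- exact: lebesgue_mitv.
- apply/measurable_EFinP; apply/measurable_funU => //; exact: lebesgue_mitv.
- apply/disj_setPS => s [/=]; rewrite !in_itv/= => /andP[_ st] /andP[ts _].
  by move: (lt_le_trans ts st); rewrite ltxx.
rewrite (integral_leb_cst fa) (integral_leb_cst fb) (integral_leb_cst ft).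
rewrite !lebesgue_measure_itv/= !lte_fin ltxx mule0 add0e.
have -> : t - delta < t by lra.
have -> : t < t + delta by lra.
rewrite -!EFinB -!EFinM -EFinD/=.
by field; lra.
Qed.

Lemma cvg_local_avg f t e : 0 < e ->
  (forall delta, 0 < delta < e -> local_avg f t delta = f t) ->
  ereal_inf [set (local_avg f t delta)%:E | delta in `]0, eta[]
    @[eta --> 0^'+] --> (f t)%:E.
Proof.
move=> e0 H; apply: cvg_near_cst; near=> eta.
rewrite (_ : [set _ | _ in _] = [set (f t)%:E]) ?ereal_inf1//.
have eta0 : 0 < eta by [].
have etae : eta < e by near: eta; exact: nbhs_right_lt.
apply/seteqP; split => [_ [s /= + <-]|_ ->].
  by rewrite in_itv/= => /andP[s0 se]; rewrite H// s0 (lt_trans se).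
exists (eta / 2); first by rewrite /= in_itv/=; lra.
by rewrite H//; lra.
Unshelve. all: by end_near. Qed.

Lemma grid_or_cell n t : (0 < n)%N -> t \in `[0, 1] ->
  (exists i : 'I_n, i%:R / n%:R < t < i.+1%:R / n%:R) \/
  (exists2 k, (k <= n)%N & t = k%:R / n%:R).
Proof.
rewrite in_itv/= => n0 /andP[t0 t1].
have n0R : 0 < n%:R :> R by rewrite ltr0n.
have tn0 : 0 <= t * n%:R by rewrite mulr_ge0.
have /andP[h1 h2] := truncn_itv tn0; set k := Num.truncn _ in h1 h2.
have kn : (k <= n)%N.
  by rewrite -(ler_nat R) (le_trans h1)// ler_piMl// ltW.
have [tk|tk] := eqVneq (k%:R) (t * n%:R).
  by right; exists k => //; rewrite tk mulfK// gt_eqF.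
have h1' : k%:R < t * n%:R by rewrite lt_neqAle tk.
have kn' : (k < n)%N.
  by rewrite -(ltr_nat R) (lt_le_trans h1')// ler_piMl// ltW.
left; exists (Ordinal kn') => /=.
by rewrite ltr_pdivrMr// ltr_pdivlMr// h1'.
Qed.

Lemma step_mean n (y : 'I_n -> R) (i j : 'I_n) t : j = i.+1 :> nat ->
  t = j%:R / n%:R -> step y t = (y i + y j) / 2.
Proof.
move=> ji ->.
have n0 : 0 < n%:R^-1 :> R by rewrite invr_gt0 ltr0n (leq_ltn_trans _ (ltn_ord i)).
have E : (fun l : 'I_n => cell l (j%:R / n%:R : R)) =1 pred2 i j.
  move=> l; rewrite /cell !ler_pM2r// !ler_nat /= ji -!val_eqE/= ji; lia.
have ij : j != i by rewrite -val_eqE/= ji; lia.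
have S (F : 'I_n -> R) : \sum_(l | pred2 i j l) F l = F i + F j.
  rewrite (bigD1 i) ?inE ?eqxx//= (big_pred1 j)// => l /=.
  by rewrite -!val_eqE/= ji; lia.
by rewrite /step !(eq_bigl _ _ E) !S.
Qed.

Lemma step_bounded n (y : 'I_n -> R) t : `|step y t| <= \sum_i `|y i|.
Proof.
rewrite /step; have [->|c0] := eqVneq (\sum_(i < n | cell i t) (1 : R)) 0.
  by rewrite invr0 mulr0 normr0 sumr_ge0.
have c1 : 1 <= \sum_(i < n | cell i t) (1 : R).
  by move: c0; rewrite sumr_const pnatr_eq0 -lt0n => c0; rewrite ler1n.
rewrite normrM normfV (ger0_norm (le_trans ler01 c1)).
rewrite ler_pdivrMr ?(lt_le_trans ltr01)//.
apply: (le_trans (ler_norm_sum _ _ _)).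
rewrite (le_trans (y := \sum_i `|y i|))//.
  by rewrite [leRHS](bigID (fun i => cell i t))/= lerDl sumr_ge0.
by rewrite ler_peMr// sumr_ge0.
Qed.

Lemma measurable_step n (y : 'I_n -> R) : (0 < n)%N ->
  measurable_fun (`[0, 1]%classic : set (lebesgueType R)) (step y).
Proof.
move=> n0.
pose D1 := \bigcup_(k < n) `]k%:R / n%:R, k.+1%:R / n%:R[%classic : set R.
pose D2 := \bigcup_(k < n.+1) `[k%:R / n%:R, k%:R / n%:R]%classic : set R.
pose F (k : nat) : interval R := if (k < n)%N then
  `]k%:R / n%:R, k.+1%:R / n%:R[ else `[(k - n)%:R / n%:R, (k - n)%:R / n%:R].
apply: (@measurable_funS _ _ (lebesgueType R) R
  (\bigcup_k ([set` F k] : set (lebesgueType R)))).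
- by apply: bigcupT_measurable => k; exact: lebesgue_mitv.
- move=> t /= /(grid_or_cell n0)[[i ti]|[k kn ->]].
    by exists i => //=; rewrite /F ltn_ord.
  by exists (n + k)%N => //=; rewrite /F ltnNge leq_addr/= addKn in_itv/= lexx.
- apply/measurable_fun_bigcup => k; first exact: lebesgue_mitv.
  rewrite /F; case: ifPn => kn.
    apply: (@measurable_fun_leb_cst _ _ (y (Ordinal kn))) => s.
    by rewrite in_itv/= => hs; exact: stepE.
  apply: (@measurable_fun_leb_cst _ _ (step y ((k - n)%:R / n%:R))) => s.
  by rewrite in_itv/= -eq_le => /eqP->.
Qed.

Lemma step_avg n (y : 'I_n -> R) t : (0 < n)%N -> t \in `[0, 1] ->
  exists2 e, 0 < e &
    forall delta, 0 < delta < e -> local_avg (step y) t delta = step y t.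
Proof.
move=> n0 t01; have [[i /andP[it ti]]|[k kn tk]] := grid_or_cell n0 t01.
  exists (Num.min (t - i%:R / n%:R) (i.+1%:R / n%:R - t)).
    by rewrite lt_min; lra.
  move=> delta; rewrite lt_min => /and3P[d0 d1 d2].
  apply: local_avg_cst => // s; rewrite in_itv/= /tminus /tplus.
  rewrite ge_max le_min => /andP[/andP[_ s1] /andP[_ s2]].
  by rewrite !(stepE _ (i := i))//; lra.
have nV0 : 0 < n%:R^-1 :> R by rewrite invr_gt0 ltr0n.
have nV1 : n%:R^-1 <= 1 :> R by rewrite invf_le1 ?ltr0n// ler1n.
have nn : n%:R / n%:R = 1 :> R by rewrite divff// pnatr_eq0 -lt0n.
exists n%:R^-1 => // delta /andP[d0 d1].
have [k0|k0] := posnP k.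
  have t0 : t = 0 by rewrite tk k0 mul0r.
  have H s : 0 <= s < n%:R^-1 -> step y s = y (Ordinal n0).
    move=> /andP[s0 s1]; apply: step_uniq => /=; last 2 first.
    - by left.
    - by right; rewrite mul1r.
    by rewrite /cell/= mul0r mul1r s0 ltW.
  apply: local_avg_cst => // s; rewrite in_itv/= /tminus /tplus.
  rewrite ge_max le_min => /andP[/andP[s0 s1] /andP[_ s2]].
  by rewrite !H//; lra.
have [kn'|kn'] := eqVneq k n.
  have t1 : t = 1 by rewrite tk kn' nn.
  have ln : (n.-1 < n)%N by rewrite ltn_predL.
  have lE : n.-1%:R / n%:R = 1 - n%:R^-1 :> R.
    by rewrite -subn1 natrB// mulrBl nn mul1r.
  have H s : 1 - n%:R^-1 < s <= 1 -> step y s = y (Ordinal ln).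
    move=> /andP[s0 s1]; apply: step_uniq => /=; last 2 first.
    - by right; rewrite lE.
    - by left; rewrite prednK.
    by rewrite /cell/= prednK// nn lE s1 andbT ltW.
  apply: local_avg_cst => // s; rewrite in_itv/= /tminus /tplus.
  rewrite ge_max le_min => /andP[/andP[s0 s1] /andP[s2 s3]].
  by rewrite !H//; lra.
have jn : (k < n)%N by rewrite ltn_neqAle kn' kn.
have inn : (k.-1 < n)%N by rewrite (leq_ltn_trans (leq_pred k)).
have kE : k.-1%:R / n%:R = t - n%:R^-1 :> R.
  by rewrite -subn1 natrB// mulrBl mul1r -tk.
have kE' : k.+1%:R / n%:R = t + n%:R^-1 :> R.
  by rewrite -addn1 natrD mulrDl mul1r -tk.
have tl : n%:R^-1 <= t by rewrite tk ler_peMl// ?ler1n// ltW.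
have tr : t + n%:R^-1 <= 1.
  by rewrite -kE' ler_pdivrMr ?ltr0n// mul1r ler_nat.
rewrite (@step_mean _ _ (Ordinal inn) (Ordinal jn))//=; last by rewrite prednK.
apply: local_avg_jump => //; [lra|lra| |] => s; rewrite in_itv/= => /andP[s1 s2].
  by apply: stepE => /=; rewrite prednK// kE -tk; lra.
by apply: stepE => /=; rewrite kE' -tk; lra.
Qed.

Lemma step_PC n (y : 'I_n -> R) : (0 < n)%N -> PC n (step y).
Proof.
move=> n0; split; last first.
  move=> i ni; exists (y (Ordinal ni)) => t ti.
  by rewrite (stepE _ (i := Ordinal ni)).
split; first split.
- exact: measurable_step.
- exists (\sum_i `|y i|); apply: aeW => t _; exact: step_bounded.
move=> t /(step_avg y n0)[e e0 He]; exact: cvg_local_avg e0 He.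
Qed.

Lemma modes_at_PC n g N (p : nat -> R) : (0 < n)%N -> PC n g ->
  is_partition N p -> (modes_at g N p <= n.*2.+1)%N.
Proof.
move=> n0 [_ gc] [p0 pN pS].
have n0R : 0 < n%:R :> R by rewrite ltr0n.
have pmono i j : (i <= j)%N -> (j <= N)%N -> p i <= p j.
  elim: j => [|j IH]; first by rewrite leqn0 => /eqP->.
  rewrite leq_eqVlt => /predU1P[->//|ij] jN.
  by rewrite (le_trans (IH ij (ltnW jN)))// ltW// pS.
have p01 i : (i <= N)%N -> 0 <= p i <= 1.
  by move=> iN; rewrite -p0 -pN !pmono.
pose q (s : R) := Num.truncn (s * n%:R).
pose b (s : R) := (q s)%:R != s * n%:R.
pose c s := ((q s).*2 + b s)%N.
have qP s : 0 <= s -> (q s)%:R <= s * n%:R < (q s).+1%:R.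
  by move=> s0; apply: truncn_itv; rewrite mulr_ge0.
have cmono s s' : 0 <= s -> s <= s' -> (c s <= c s')%N.
  move=> s0 ss'; have /andP[h1 h2] := qP _ s0.
  have /andP[h3 h4] := qP _ (le_trans s0 ss').
  have sn : s * n%:R <= s' * n%:R by rewrite ler_pM2r.
  have : (q s < (q s').+1)%N by rewrite -(ltr_nat R); lra.
  rewrite ltnS leq_eqVlt => /predU1P[qq|]; last by rewrite /c; lia.
  rewrite /c qq leq_add2l /b qq.
  have [E|_] := eqVneq (q s')%:R (s' * n%:R); last exact: leq_b1.
  rewrite [_ == _](_ : _ = true)//; apply/eqP.
  by rewrite -qq in E *; lra.
have cg : forall s s', 0 <= s -> s <= 1 -> 0 <= s' -> s' <= 1 ->
    c s = c s' -> g s = g s'.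
  move=> s s' s0 s1 s'0 s'1 cc.
  have qq : q s = q s' by move: cc; rewrite /c; do 2 case: (b _); lia.
  have bb : b s = b s' by move: cc; rewrite /c; do 2 case: (b _); lia.
  have /andP[h1 h2] := qP _ s0; have /andP[h3 h4] := qP _ s'0.
  have [bs|bs] := boolP (b s); last first.
    have bs' : ~~ b s' by rewrite -bb.
    congr g; apply: (mulIf (x := n%:R)); first by rewrite gt_eqF.
    by move: bs bs'; rewrite !negbK qq => /eqP <- /eqP <-.
  have bs' : b s' by rewrite -bb.
  have k1 : (q s)%:R < s * n%:R by rewrite lt_neqAle h1 andbT.
  have k3 : (q s')%:R < s' * n%:R by rewrite lt_neqAle h3 andbT.
  have qn : (q s < n)%N.
    by rewrite -(ltr_nat R) (lt_le_trans k1)// ler_piMl// ltW.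
  have [C HC] := gc _ qn.
  have inC x : (q s)%:R < x * n%:R < (q s).+1%:R -> g x = C.
    by move=> hx; apply: HC; rewrite ltr_pdivrMr// ltr_pdivlMr.
  by rewrite !inC ?k1//= qq k3.
have cN s : 0 <= s -> s <= 1 -> (c s < n.*2.+1)%N.
  move=> s0 s1; have -> : n.*2.+1 = (c 1).+1.
    by rewrite /c /b /q mul1r natrK eqxx addn0.
  by rewrite ltnS cmono.
pose B i := Num.max (g (p i.-1)) (g (p i.+1)) < g (p i).
pose r := [seq i <- index_iota 1 N | B i].
have -> : modes_at g N p = size r.
  by rewrite size_filter -sum1_count big_mkcond.
rewrite -(size_map (c \o p)) -[leqRHS](size_iota 0); apply: uniq_leq_size.
  have key i j : (i < j < N)%N -> B i -> c (p i) <> c (p j).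
    move=> /andP[ij jN] Bi E.
    have /andP[u1 u2] := p01 i (ltnW (ltn_trans ij jN)).
    have /andP[u3 u4] := p01 i.+1 (leq_trans ij (ltnW jN)).
    have E' : c (p i) = c (p i.+1).
      apply/eqP; rewrite eqn_leq cmono ?pmono ?(leq_trans ij (ltnW jN))//=.
      by rewrite E cmono// pmono// ltnW.
    by move: Bi; rewrite /B (cg _ _ u1 u2 u3 u4 E') gt_max ltxx andbF.
  rewrite map_inj_in_uniq ?filter_uniq ?iota_uniq// => i j.
  rewrite !mem_filter !mem_index_iota => /and3P[Bi _ iN] /and3P[Bj _ jN] /= E.
  case: (ltngtP i j) => // ij.
  - by case: (key i j); rewrite ?ij.
  - by case: (key j i); rewrite ?ij.
move=> _ /mapP[i + ->]; rewrite mem_filter mem_index_iota => /and3P[_ _ iN].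
have /andP[u1 u2] := p01 i (ltnW iN).
by rewrite mem_iota/= cN.
Qed.

Lemma dKxx g : dK g g = 0%E.
Proof.
rewrite /dK (_ : [set _ | _ in _] = [set 0%E]) ?ereal_sup1//.
have I0 (x : R) : `|\int[leb]_(s in `[0, x]) (g s - g s)|%:E = 0%E.
  rewrite (@eq_Rintegral _ _ _ _ _ (fun=> 0)) => [|s _]; last by rewrite subrr.
  by rewrite /Rintegral integral0 normr0.
apply/seteqP; split => [_ [x _ <-]|_ ->]; first by rewrite I0.
by exists 0; rewrite ?I0//= in_itv/= lexx ler01.
Qed.

Lemma k_etaP n eta g : (0 < n)%N -> 0 < eta -> PC n g ->
  kset n eta g (k_ n eta g) /\ ubound (kset n eta g) (k_ n eta g).
Proof.
move=> n0 eta0 gPC; rewrite /k_; case: xgetP => [j _ //|none]; exfalso.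
have K0 : kset n eta g 0%N by rewrite /kset/= leey.
have Kub j : kset n eta g j -> (j <= n.*2.+2)%N.
  case: j => // j; rewrite /kset /mkset (_ : j.+1%:Z - 1 = j%:Z); last by lia.
  move=> /= sj; rewrite ltnS leqNgt; apply/negP => jn.
  move: sj; rewrite leNgt => /negP; apply.
  apply: (@le_lt_trans _ _ 0%E); last by rewrite lte_fin.
  apply: ereal_inf_lbound; exists g; last exact: dKxx.
  split => //; apply: ge_ereal_sup => _ [N [p [pp ->]]].
  by rewrite lee_fin ler_nat (leq_trans (modes_at_PC n0 gPC pp))// ltnW.
have E : exists j, `[< kset n eta g j >] by exists 0%N; exact/asboolP.
have U j : `[< kset n eta g j >] -> (j <= n.*2.+2)%N by move=> /asboolP/Kub.
have [j /asboolP jK jmax] := ex_maxnP E U.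
by apply: (none j); split => // i /asboolT; exact: jmax.
Qed.

End Defs.

(* Main.v *)
Require Import Defs.
From HB Require Import structures.
From mathcomp Require Import all_boot all_order all_algebra.
From mathcomp Require Import all_classical all_reals all_analysis.
From mathcomp Require Import measurable_realfun ring lra zify.

Set Implicit Arguments.
Unset Strict Implicit.
Unset Printing Implicit Defensive.

Import Order.TTheory GRing.Theory Num.Theory.
Import numFieldNormedType.Exports.

Local Open Scope classical_set_scope.
Local Open Scope ring_scope.

(* The Kolmogorov distance between two step functions with cell values y and z
   is the maximum of |sum_(i < m) (y i - z i)| / n over m <= n. Hence, if the
   partial sums of the noise stay below n * eps / 2, then Y^(n) is closer than
   eps / 2 to f^(n), which has at most k modes, and by the triangle inequality
   at least eps / 2 away from every function with at most k - 1 modes.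
   The complementary event is controlled by a maximal Bernstein inequality,
   for which the partial sums are frozen once they exceed the threshold.
   The event k_(eps/2)(Y^(n)) = k is measurable because the distance to
   X_j^(n) is a Lipschitz function of the cell values. *)

(** * Maximal Bernstein inequality *)

Section independence.
Context d (T : measurableType d) (R : realType) (P : probability T R).
Local Open Scope ereal_scope.

(** By uniqueness of the product measure, the law of the pair is the product of the two laws;
    Tonelli's theorem then separates the integral. *)
Lemma expectation_mul_indep (X Y : T -> R) :
  measurable_fun setT X -> measurable_fun setT Y ->
  (forall w, 0 <= X w)%R -> (forall w, 0 <= Y w)%R ->
  (forall A B, measurable A -> measurable B ->
    P (X @^-1` A `&` Y @^-1` B) = P (X @^-1` A) * P (Y @^-1` B)) ->
  'E_P[fun w => (X w * Y w)%R] = 'E_P[X] * 'E_P[Y].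
Proof.
move=> mX mY X0 Y0 XY; rewrite unlock.
pose X' : {RV P >-> R} := mfun_Sub (mem_set mX).
pose Y' : {RV P >-> R} := mfun_Sub (mem_set mY).
have mXY : measurable_fun setT (fun w => (X w, Y w)) by exact: measurable_fun_pair.
pose XY' : {RV P >-> (R * R)%type} := mfun_Sub (mem_set mXY).
have lawE A : measurable A ->
    (distribution P X' \x distribution P Y') A = distribution P XY' A.
  by apply: product_measure_unique => {}A B mA mB; rewrite -XY.
have mnorm : measurable_fun setT (fun y : R => `|y|%:E).
  by apply/measurable_EFinP; exact: normr_measurable.
(* The absolute values make the integrand nonnegative on the whole plane, as Tonelli's theorem
   requires; they change nothing on the range of the pair. *)
pose f (z : R * R) : \bar R := (`|z.1| * `|z.2|)%:E.
have mf : measurable_fun setT f.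
  apply/measurable_EFinP; apply: measurable_funM;
    by apply: measurableT_comp => //.
have f0 z : 0 <= f z by rewrite lee_fin mulr_ge0.
transitivity (\int[P]_w (f \o XY') w).
  by apply: eq_integral => w _; rewrite /f/= !ger0_norm.
rewrite -ge0_integral_distribution//.
transitivity (\int[distribution P X' \x distribution P Y']_z f z).
  by apply: eq_measure_integral => A mA _; apply/esym; exact: lawE.
rewrite fubini_tonelli1// /fubini_F/=.
transitivity (\int[distribution P X']_x ((`|x|)%:E * 'E_P[Y])).
  apply: eq_integral => x _; rewrite /f/=.
  under eq_integral do rewrite EFinM.
  rewrite ge0_integralZl//=.
  rewrite (ge0_integral_distribution Y' (f := fun y => `|y|%:E))//.
  by rewrite unlock; congr (_ * _); apply: eq_integral => w _ /=; rewrite ger0_norm.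
rewrite ge0_integralZr//=; last exact: expectation_ge0.
rewrite (ge0_integral_distribution X' (f := fun y => `|y|%:E))//.
by rewrite unlock; congr (_ * _); apply: eq_integral => w _ /=; rewrite ger0_norm.
Qed.

Variables (n : nat) (X : 'I_n -> {RV P >-> R}).

(** Only rectangles are taken: they form a pi-system, and the sigma-algebra of the first [m]
    variables is recovered as [<<s past m >>]. *)
Definition past (m : nat) : set (set T) :=
  [set A | exists2 B : 'I_n -> set R, forall i, measurable (B i) &
    A = \bigcap_(i in [set i : 'I_n | (i < m)%N]) (X i @^-1` B i)].

Lemma past_measurable m : past m `<=` measurable.
Proof.
move=> _ [B mB ->]; apply: fin_bigcap_measurable => // i _.
exact: measurable_funPTI.
Qed.

Lemma past_setI m : setI_closed (past m).
Proof.
move=> _ _ [B mB ->] [C mC ->]; exists (fun i => B i `&` C i).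
  by move=> i; exact: measurableI.
by rewrite -bigcapI.
Qed.

Hypothesis indepX : mutually_independent X.

(** The product formula over the indices up to [m], with [C] as the side at [m], splits off the
    factor at [m]; the remaining factors are the product formula over the indices below [m]. *)
Lemma past_rect_indep (m : 'I_n) (A : set T) (C : set R) : past m A ->
  measurable C -> P (A `&` X m @^-1` C) = P A * P (X m @^-1` C).
Proof.
move=> [B mB ->] mC.
pose B' i := if i == m then C else B i.
have mB' i : measurable (B' i) by rewrite /B'; case: ifP.
have E : [set` [set i : 'I_n | (i < m)%N]%SET] = [set i : 'I_n | (i < m)%N].
  by apply/seteqP; split=> i /=; rewrite inE.
have := indepX [set i : 'I_n | (i < m)%N]%SET mB.
have := indepX [set i : 'I_n | (i <= m)%N]%SET mB'.
rewrite (bigD1 m)/= ?inE// {2}/B' eqxx muleC.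
rewrite (eq_bigl (fun i => i \in [set i : 'I_n | (i < m)%N]%SET)); last first.
  by move=> i; rewrite !inE ltn_neqAle andbC.
rewrite (eq_bigr (fun i => P (X i @^-1` B i))); last first.
  by move=> i; rewrite inE /B' => im; rewrite -val_eqE/= ltn_eqF.
move=> + EB; rewrite -EB E => <-; congr (P _).
apply/seteqP; split => w /=.
  move=> [Bw Cw] i /=; rewrite inE leq_eqVlt => /orP[|im].
    by rewrite /B' -val_eqE => /[dup] /eqP /val_inj -> ->.
  by rewrite /B' -val_eqE/= ltn_eqF//; exact: Bw.
move=> Bw; split=> [i /= im|].
  by have := Bw i; rewrite /= inE /B' -val_eqE/= ltn_eqF// => /(_ (ltnW im)).
by have := Bw m; rewrite /= inE /B' eqxx => /(_ (leqnn _)).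
Qed.

(** Dynkin's pi-lambda argument: for fixed [C], the product formula passes to complements and to
    countable disjoint unions, and it holds on the pi-system [past m]. *)
Lemma past_indep (m : 'I_n) (A : set T) (C : set R) : <<s past m >> A ->
  measurable C -> P (A `&` X m @^-1` C) = P A * P (X m @^-1` C).
Proof.
move=> sA mC; have mXC : measurable (X m @^-1` C) by exact: measurable_funPTI.
have sub : <<s past m >> `<=` measurable.
  apply: smallest_sub; [exact: sigma_algebra_measurable|exact: past_measurable].
pose Q (B : set T) := P (B `&` X m @^-1` C) = P B * P (X m @^-1` C).
have QC (B : set T) : measurable B -> Q B -> Q (~` B).
  rewrite /Q => mB QB.
  rewrite setIC -setDE measureD ?ltey_eq ?fin_num_measure//=.
  rewrite (_ : X m @^-1` C `&` B = B `&` X m @^-1` C) ?QB; last exact: setIC.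
  by rewrite probability_setC// muleBl ?mul1e ?fin_num_measure.
have QU (F : (set T)^nat) : (forall i, measurable (F i)) -> trivIset setT F ->
    (forall i, Q (F i)) -> Q (\bigcup_i F i).
  rewrite /Q => mF tF QF; rewrite setI_bigcupl !measure_bigcup//=.
  - have PC : P (X m @^-1` C) = (fine (P (X m @^-1` C)))%:E.
      by rewrite fineK// fin_num_measure.
    rewrite PC.
    under eq_eseriesr do rewrite QF PC.
    under eq_eseriesr do rewrite muleC.
    by rewrite nneseriesZl// muleC.
  - by move=> i _; exact: measurableI.
  - exact: trivIset_setIr.
apply: (@dynkin_induction _ (g_sigma_algebraType (past m)) (past m) Q) => //.
- exact: past_setI.
- by rewrite /Q setTI probability_setT mul1e.
- by move=> B Bm; exact: past_rect_indep.
- by move=> B /sub; exact: QC.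
- by move=> F mF; apply: QU => i; apply: sub; exact: mF.
Qed.

(* Freezing the partial sums once they reach [t] reduces the maximal inequality
   to a Chernoff bound for the single random variable [stopped_sum t n]; the
   value of [X] beyond index [n] is taken to be 0. *)
Fixpoint stopped_sum (t : R) (m : nat) (w : T) : R :=
  if m is j.+1 then
    let z := stopped_sum t j w in
    if (z < t)%R then (z + oapp (fun i => X i w) 0 (insub j))%R else z
  else 0.

(* [e] is the identity, from [T] or from [T] with the sigma-algebra generated
   by the past. *)
Lemma measurable_stopped_sum t (m : nat) d' (T' : measurableType d') (e : T' -> T) :
  (forall i : 'I_n, (i < m)%N -> measurable_fun setT (X i \o e)) ->
  measurable_fun setT (stopped_sum t m \o e).
Proof.
elim: m => [|m IH] mX; first exact: measurable_cst.
have mZ := IH (fun i im => mX i (ltnW im)).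
rewrite (_ : _ \o _ = fun w => if ((stopped_sum t m \o e) w < t)%R
  then ((stopped_sum t m \o e) w + oapp (fun i => X i (e w)) 0 (insub m))%R
  else (stopped_sum t m \o e) w)//.
apply: measurable_fun_ifT => //.
  exact: measurable_fun_ltr.
apply: measurable_funD => //.
case: insubP => [i _ im|_] //=.
by apply: mX; rewrite im.
Qed.

(** The recursion up to [m] reads only variables of index below [m]. With [past_indep] this makes
    the stopped sum independent of the next increment [X m]. *)
Lemma past_stopped_sum t (m : 'I_n) (A : set R) : measurable A ->
  <<s past m >> (stopped_sum t m @^-1` A).
Proof.
move=> mA.
have : measurable_fun [set: g_sigma_algebraType (past m)]
    (stopped_sum t m \o (id : g_sigma_algebraType (past m) -> T)).
  apply: measurable_stopped_sum => i im _ B mB.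
  rewrite setTI; apply: sub_gen_smallest.
  exists (fun j => if j == i then B else setT) => [j|]; first by case: ifP.
  apply/seteqP; split => w /=.
    by move=> Bw j /= _; case: eqP => [->|].
  by move=> /(_ i im); rewrite /= eqxx.
by move=> /(_ measurableT A mA); rewrite setTI.
Qed.

Lemma measurable_partial_sum (j : nat) :
  measurable_fun setT (fun w => \sum_(i < n | (i < j)%N) X i w)%R.
Proof.
under eq_fun do rewrite big_mkcond.
by apply: measurable_sum => i; case: (i < j)%N;
  [exact: measurable_funPT|exact: measurable_cst].
Qed.

Lemma measurable_max_partial_sum_ge (t : R) : measurable
  [set w | exists2 j, (j <= n)%N & (t <= \sum_(i < n | (i < j)%N) X i w)%R].
Proof.
rewrite (_ : [set w | _] = \bigcup_(j in [set j | (j <= n)%N])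
  ((fun w => \sum_(i < n | (i < j)%N) X i w)%R @^-1` `[t, +oo[)).
  apply: bigcup_measurable => j _.
  by rewrite -[X in measurable X]setTI; exact: measurable_partial_sum.
apply/seteqP; split => w /= [j jn tj]; exists j => //=.
  by rewrite in_itv/= tj.
by move: tj; rewrite /= in_itv/= andbT.
Qed.

Lemma stopped_sum_ge t m w : (0 < t)%R ->
  (exists2 j, (j <= m)%N & (t <= \sum_(i < n | (i < j)%N) X i w)%R) ->
  (t <= stopped_sum t m w)%R.
Proof.
move=> t0.
pose S j := (\sum_(i < n | (i < j)%N) X i w)%R.
have S1 j : S j.+1 = (S j + oapp (fun i => X i w) 0 (insub j))%R.
  rewrite /S; case: insubP => [i _ ij|jn] /=.
    rewrite (bigD1 i) ?ij//= addrC; congr (_ + _)%R.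
    by apply: eq_bigl => k; rewrite ltnS -val_eqE/= ij ltn_neqAle andbC.
  rewrite addr0; apply: eq_bigl => k; apply/idP/idP; last exact: ltnW.
  by move=> _; rewrite (leq_trans (ltn_ord k))// leqNgt.
(* Invariant of the recursion: either the threshold has been reached and the value is frozen, or the
   value is the ordinary partial sum and no partial sum so far has reached [t]. It starts in the
   second case because the empty sum 0 is below [t]. *)
suff H : (t <= stopped_sum t m w)%R \/
    (stopped_sum t m w = S m /\ forall j, (j <= m)%N -> (S j < t)%R).
  by move=> [j jm tj]; case: H => // -[_ /(_ j jm)]; rewrite ltNge tj.
elim: m => [|m [IH|[IH1 IH2]]] /=.
- right; rewrite /S big_pred0//; split=> // j; rewrite leqn0 => /eqP ->.
  by rewrite big_pred0.
- by rewrite ltNge IH/=; left.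
- rewrite IH1 IH2// -S1; have [|St] := leP t (S m.+1); first by left.
  right; split=> // j; rewrite leq_eqVlt => /predU1P[->//|].
  by rewrite ltnS; exact: IH2.
Qed.

(** Each step multiplies the exponential moment by at most [expR psi]: where the sum still runs, by
    independence of the new increment from the past; where it is frozen, the factor is 1, which is
    at most [expR psi] since [psi] is nonnegative. *)
Lemma mgf_stopped_sum t (l psi : R) : (0 <= psi)%R ->
  (forall i, 'E_P[fun w => expR (l * X i w)] <= (expR psi)%:E) ->
  forall m, 'E_P[fun w => expR (l * stopped_sum t m w)] <= (expR (m%:R * psi))%:E.
Proof.
move=> psi0 mgfX; elim=> [|m IH].
  rewrite mul0r (_ : (fun w => _) = cst (expR 0)) ?expectation_cst//.
  by apply/funext => w /=; rewrite mulr0.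
have mZ k : measurable_fun setT (stopped_sum t k).
  by apply: (@measurable_stopped_sum t k _ _ id) => i _; exact: measurable_funPT.
(* From index [n] on the increments are the default 0, so the stopped sum no longer changes. *)
have [mn|nm] := ltnP m n; last first.
  rewrite (_ : (fun w => _) = fun w => expR (l * stopped_sum t m w)).
    by rewrite (le_trans IH)// lee_fin ler_expR ler_wpM2r// ler_nat.
  by apply/funext => w /=; rewrite insubN ?addr0 ?if_same// -leqNgt.
pose i := Ordinal mn.
have mE : measurable_fun [set: R] (fun z : R => expR (l * z)).
  by apply: measurableT_comp; [exact: measurable_expR | exact: mulrl_measurable].
pose phi (z : R) : R := if (z < t)%R then expR (l * z) else 0%R.
have mphi : measurable_fun setT phi.
  by apply: measurable_fun_ifT => //; exact: measurable_fun_ltr.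
pose chi (z : R) : R := if (z < t)%R then 0%R else expR (l * z).
have mchi : measurable_fun setT chi.
  by apply: measurable_fun_ifT => //; exact: measurable_fun_ltr.
have phi0 z : (0 <= phi z)%R by rewrite /phi; case: ifP; rewrite // expR_ge0.
have chi0 z : (0 <= chi z)%R by rewrite /chi; case: ifP; rewrite // expR_ge0.
have mphiZ : measurable_fun setT (phi \o stopped_sum t m) by exact: measurableT_comp.
have mchiZ : measurable_fun setT (chi \o stopped_sum t m) by exact: measurableT_comp.
have mEX : measurable_fun setT (fun w => expR (l * X i w)).
  by apply: (measurableT_comp mE); exact: measurable_funPT.
have EZ : 'E_P[fun w => expR (l * stopped_sum t m w)] =
    'E_P[phi \o stopped_sum t m] + 'E_P[chi \o stopped_sum t m].
  rewrite unlock -ge0_integralD//=; first last.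
  - exact/measurable_EFinP.
  - by move=> w _; rewrite lee_fin.
  - exact/measurable_EFinP.
  - by move=> w _; rewrite lee_fin.
  apply: eq_integral => w _; rewrite -EFinD /phi /chi.
  by case: ifP; rewrite ?addr0 ?add0r.
have EZ1 : 'E_P[fun w => expR (l * stopped_sum t m.+1 w)] =
    'E_P[fun w => (phi (stopped_sum t m w) * expR (l * X i w))%R] +
    'E_P[chi \o stopped_sum t m].
  rewrite unlock -ge0_integralD//=; first last.
  - exact/measurable_EFinP.
  - by move=> w _; rewrite lee_fin.
  - by apply/measurable_EFinP; exact: measurable_funM.
  - by move=> w _; rewrite lee_fin mulr_ge0// expR_ge0.
  apply: eq_integral => w _; rewrite -EFinD /phi /chi insubT/=.
  by case: ifP; rewrite ?mul0r ?addr0 ?add0r// mulrDr expRD.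
rewrite EZ1 (expectation_mul_indep mphiZ mEX); first last.
- move=> A B mA mB.
  rewrite comp_preimage (_ : _ @^-1` B = X i @^-1` ((fun z => expR (l * z)) @^-1` B))//.
  apply: past_indep.
    by apply: past_stopped_sum; rewrite -[X in measurable X]setTI; exact: mphi.
  by rewrite -[X in measurable X]setTI; exact: mE.
- by move=> w; exact: expR_ge0.
- by move=> w; exact: phi0.
have Ephi : 0 <= 'E_P[phi \o stopped_sum t m].
  by apply: expectation_ge0 => w; exact: phi0.
have Echi : 0 <= 'E_P[chi \o stopped_sum t m].
  by apply: expectation_ge0 => w; exact: chi0.
apply: (@le_trans _ _ ((expR psi)%:E * 'E_P[fun w => expR (l * stopped_sum t m w)])).
  rewrite EZ ge0_muleDr//; apply: leeD.
    by rewrite muleC; apply: lee_wpmul2r; [exact: Ephi|exact: mgfX].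
  rewrite -[leLHS]mul1e; apply: lee_wpmul2r; first exact: Echi.
  by rewrite lee_fin -expR0 ler_expR.
rewrite -natr1 mulrDl mul1r expRD EFinM muleC.
by rewrite lee_wpmul2r// lee_fin expR_ge0.
Qed.

Lemma maximal_chernoff (t l psi : R) : (0 < t)%R -> (0 < l)%R -> (0 <= psi)%R ->
  (forall i, 'E_P[fun w => expR (l * X i w)] <= (expR psi)%:E) ->
  P [set w | exists2 j, (j <= n)%N & (t <= \sum_(i < n | (i < j)%N) X i w)%R]
   <= (expR (n%:R * psi - l * t))%:E.
Proof.
move=> t0 l0 psi0 mgfX.
have mZ : measurable_fun setT (stopped_sum t n).
  by apply: (@measurable_stopped_sum t n _ _ id) => i _; exact: measurable_funPT.
pose Z : {RV P >-> R} := mfun_Sub (mem_set mZ).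
apply: (@le_trans _ _ (P [set w | (t <= Z w)%R])).
  apply: le_measure; rewrite ?inE.
  - exact: measurable_max_partial_sum_ge.
  - rewrite (_ : [set w | _] = Z @^-1` `[t, +oo[); first exact: measurable_funPTI.
    by apply/seteqP; split => w /=; rewrite in_itv/= andbT.
  - by move=> w /= H; exact: stopped_sum_ge.
apply: (le_trans (chernoff Z t l0)).
rewrite expRD EFinM expRN -expRN lee_wpmul2r ?lee_fin ?expR_ge0//.
apply: le_trans (mgf_stopped_sum t psi0 mgfX n).
rewrite /mmt_gen_fun le_eqVlt (_ : _ \o _ = fun w => expR (l * stopped_sum t n w)) ?eqxx//.
by apply/funext => w /=; rewrite mulrC.
Qed.

End independence.

(** * Exponential moments under Bernstein's moment condition *)

Lemma expR_sub_affine_le (R : realType) (y : R) :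
  ((expR y - 1 - y)%:E <= \sum_(0 <= m <oo) (`|y| ^+ m.+2 / m.+2`!%:R)%:E)%E.
Proof.
set s := limn _.
have u0 m : (0 <= (`|y| ^+ m.+2 / m.+2`!%:R)%:E)%E.
  by rewrite lee_fin divr_ge0// exprn_ge0.
have s0 : (0 <= s)%E by apply: nneseries_ge0 => m _ _; exact: u0.
have [soo|soo] := eqVneq s +oo%E; first by rewrite soo leey.
have sfin : s \is a fin_num by rewrite ge0_fin_numE// ltey.
rewrite -(fineK sfin) lee_fin -addrA -opprD lerBlDr.
apply: limr_le; first exact: is_cvg_series_exp_coeff.
exists 2%N => // -[|[|N]]//= _.
rewrite seriesEnat; change (\sum_(0 <= m < N.+2) exp_coeff y m <= fine s + (1 + y)).
rewrite big_nat_recl// big_nat_recl//= addrA addrC.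
rewrite /exp_coeff/= expr0 expr1 fact0 divr1 divr1 lerD//.
(* After the terms 1 and [y] are split off, [y] is replaced by its absolute value, so that the
   series has nonnegative terms and can later be integrated term by term against the absolute
   moments. *)
apply: (@le_trans _ _ (\sum_(0 <= m < N) (`|y| ^+ m.+2 / m.+2`!%:R))).
  apply: ler_sum => m _; rewrite ler_pM2r ?invr_gt0 ?ltr0n ?fact_gt0//.
  by rewrite -normrX ler_norm.
rewrite -lee_fin fineK// -sumEFin.
exact: nneseries_lim_ge.
Qed.

Section bernstein.
Context d (T : measurableType d) (R : realType) (P : probability T R).
Local Open Scope ereal_scope.
Variables v kappa : R.
Hypotheses (kappa0 : (0 < kappa)%R) (v0 : (0 < v)%R).

Definition bernstein_moments (X : T -> R) : Prop :=
  forall m, (2 <= m)%N -> 'E_P[fun w => (`|X w| ^+ m)%R]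
    <= (v * m`!%:R * kappa ^+ (m - 2) / 2)%:E.

Lemma bernstein_integrable (X : {RV P >-> R}) : bernstein_moments X ->
  P.-integrable setT (EFin \o X).
Proof.
move=> /(_ 2%N isT); rewrite unlock => EX2.
have mX2 : measurable_fun setT (fun w => `|X w| ^+ 2)%R.
  apply: (measurable_funX 2); apply: measurableT_comp => //.
apply: (@le_integrable _ _ _ _ _ _ _ (fun w => 1 + (`|X w| ^+ 2)%:E)) => //.
- exact/measurable_EFinP/measurable_funPT.
- move=> w _; rewrite -EFinD /= lee_fin.
  rewrite [leRHS]ger0_norm ?addr_ge0 ?sqr_ge0//.
  by set x := `|X w|%R; nra.
- apply: integrableD => //; first exact: finite_measure_integrable_cst.
  apply/integrableP; split; first exact/measurable_EFinP.
  under eq_integral do rewrite gee0_abs ?lee_fin ?sqr_ge0//.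
  by rewrite (le_lt_trans EX2)// ltry.
Qed.

(** Since the mean is zero, only the terms of order at least 2 of the exponential series add to 1.
    The moment bounds dominate them by a geometric series with sum [c], and [1 + c <= expR c]. *)
Lemma bernstein_mgf (X : {RV P >-> R}) (l : R) : 'E_P[X] = 0 ->
  bernstein_moments X -> (0 < l)%R -> (l * kappa < 1)%R ->
  'E_P[fun w => expR (l * X w)] <=
    (expR (l ^+ 2 * v / (2 * (1 - l * kappa))))%:E.
Proof.
move=> EX0 mom l0 lk.
have mX : measurable_fun setT X by exact: measurable_funPT.
have intX := bernstein_integrable mom.
set c := (l ^+ 2 * v / (2 * (1 - l * kappa)))%R.
pose g w := (expR (l * X w) - 1 - l * X w)%R.
have mlX : measurable_fun setT (fun w => l * X w)%R by exact: measurable_funM.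
have mg : measurable_fun setT g.
  apply: measurable_funB => //; apply: measurable_funB => //.
  by apply: measurableT_comp => //; exact: measurable_expR.
have g0 w : (0 <= g w)%R by have := expR_ge1Dx (l * X w); rewrite /g; lra.
have mXm m : measurable_fun setT (fun w => `|X w| ^+ m)%R.
  by apply: (measurable_funX m); exact: measurableT_comp.
have Eg : \int[P]_w (g w)%:E <= c%:E.
  apply: (@le_trans _ _ (\int[P]_w
      \sum_(0 <= m <oo) (`|l * X w| ^+ m.+2 / m.+2`!%:R)%:E)).
    apply: ge0_le_integral => //.
    - by move=> w _; rewrite lee_fin.
    - exact/measurable_EFinP.
    - apply: ge0_emeasurable_sum => [m w _ _|m _].
        by rewrite lee_fin divr_ge0// exprn_ge0.
      apply/measurable_EFinP; apply: measurable_funM => //.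
      by apply: (measurable_funX m.+2); exact: measurableT_comp.
    - by move=> w _; exact: expR_sub_affine_le.
  rewrite integral_nneseries//; last first.
    move=> m; apply/measurable_EFinP; apply: measurable_funM => //.
    by apply: (measurable_funX m.+2); exact: measurableT_comp.
  (* The factorial of the moment bound cancels that of the series, which leaves a geometric term of
     ratio [l * kappa]. *)
  have Em m : \int[P]_w (`|l * X w| ^+ m.+2 / m.+2`!%:R)%:E <=
      (geometric (l ^+ 2 * v / 2) (l * kappa) m)%:E.
    have m2 : (0 < m.+2`!%:R :> R)%R by rewrite ltr0n fact_gt0.
    rewrite (_ : \int[P]_w _ =
        \int[P]_w ((l ^+ m.+2 / m.+2`!%:R)%:E * (`|X w| ^+ m.+2)%:E)); last first.
      apply: eq_integral => w _.
      by rewrite -EFinM normrM exprMn (gtr0_norm l0) mulrAC.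
    rewrite ge0_integralZl//; last 2 first.
    - exact/measurable_EFinP.
    - by rewrite lee_fin divr_ge0// exprn_ge0// ltW.
    have := mom m.+2 isT; rewrite unlock => momm.
    apply: (le_trans (lee_wpmul2l _ momm)).
      by rewrite lee_fin divr_ge0// exprn_ge0// ltW.
    rewrite -EFinM lee_fin subn2/= exprMn le_eqVlt; apply/orP; left; apply/eqP.
    by rewrite !exprS; field; rewrite gt_eqF.
  apply: (@le_trans _ _ (\sum_(0 <= m <oo)
      (geometric (l ^+ 2 * v / 2) (l * kappa) m)%:E)).
    apply: lee_nneseries => [m _ _|m _]; last exact: Em.
    by apply: integral_ge0 => w _; rewrite lee_fin divr_ge0// exprn_ge0.
  apply: lime_le.
    apply: is_cvg_nneseries => m _ _; rewrite lee_fin.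
    by apply: geometric_ge0; rewrite ?mulr_ge0 ?sqr_ge0 ?invr_ge0// ltW.
  near=> N; rewrite sumEFin lee_fin.
  apply: (le_trans (geometric_le_lim N _ _ _)).
  - by rewrite ?mulr_ge0 ?sqr_ge0 ?invr_ge0// ltW.
  - exact: mulr_gt0.
  - by rewrite gtr0_norm// mulr_gt0.
  rewrite le_eqVlt; apply/orP; left; apply/eqP.
  by rewrite /c; field; rewrite gt_eqF ?subr_gt0.
have intg : P.-integrable setT (EFin \o g).
  apply/integrableP; split; first exact/measurable_EFinP.
  under eq_integral do rewrite gee0_abs ?lee_fin ?g0//.
  by rewrite (le_lt_trans Eg)// ltry.
have int1 : P.-integrable setT (cst 1%:E : T -> \bar R).
  exact: finite_measure_integrable_cst.
have intlX : P.-integrable setT (fun w => l%:E * (X w)%:E).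
  exact: integrableZl.
have -> : 'E_P[fun w => expR (l * X w)] =
    \int[P]_w ((g w)%:E + (1 + l%:E * (X w)%:E)).
  rewrite unlock; apply: eq_integral => w _.
  by rewrite -EFinM -!EFinD /g; congr EFin; ring.
rewrite integralD//; last exact: integrableD.
rewrite integralD// integralZl//.
move: EX0; rewrite unlock => ->.
have P1 : P [set: T] = 1 by exact: probability_setT.
rewrite integral_cst//= [X in _ + (_ * X + _)]P1 mule0 adde0 mule1.
apply: (@le_trans _ _ (c%:E + 1%:E)); first exact: leeD2r.
by rewrite -EFinD lee_fin addrC expR_ge1Dx.
Unshelve. all: by end_near. Qed.

Lemma bernstein_maximal n (X : 'I_n -> {RV P >-> R}) (t : R) :
  (0 < n)%N -> (0 < t)%R -> mutually_independent X ->
  (forall i, 'E_P[X i] = 0) -> (forall i, bernstein_moments (X i)) ->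
  P [set w | exists2 j, (j <= n)%N & (t <= \sum_(i < n | (i < j)%N) X i w)%R]
   <= (expR (- (t ^+ 2 / (2 * (n%:R * v + kappa * t)))))%:E.
Proof.
move=> n0 t0 indX EX mom.
have nv : (0 < n%:R * v)%R by rewrite mulr_gt0// ltr0n.
have kt : (0 < kappa * t)%R by exact: mulr_gt0.
have D0 : (0 < n%:R * v + kappa * t)%R by exact: addr_gt0.
(* With [D] for the denominator, this choice gives [1 - l * kappa = n%:R * v / D]. Hence [n] times
   the exponent from [bernstein_mgf] is [t ^+ 2 / (2 * D)], half of [l * t]. *)
set l := (t / (n%:R * v + kappa * t))%R.
have l0 : (0 < l)%R by exact: divr_gt0.
have lk : (l * kappa < 1)%R.
  by rewrite /l mulrAC ltr_pdivrMr// mul1r mulrC; lra.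
have := maximal_chernoff indX t0 l0 _ (fun i => bernstein_mgf (EX i) (mom i) l0 lk).
rewrite (_ : (n%:R * _ - l * t)%R = (- (t ^+ 2 / (2 * (n%:R * v + kappa * t))))%R).
  apply; apply: divr_ge0; first by rewrite mulr_ge0 ?sqr_ge0 ?ltW.
  by rewrite mulr_ge0 ?subr_ge0 ?ltW.
have E : (1 - l * kappa = n%:R * v / (n%:R * v + kappa * t))%R.
  by rewrite /l; field; rewrite gt_eqF.
have n0R : (n%:R != 0 :> R)%R by rewrite pnatr_eq0 -lt0n.
by rewrite E /l; field; rewrite n0R !gt_eqF.
Qed.

End bernstein.

(** * Two-sided maximal inequality, by a union bound over the variables and their negatives *)

Section bernstein_two_sided.
Context d (T : measurableType d) (R : realType) (P : probability T R).
Local Open Scope ereal_scope.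

Lemma mutually_independentN (I : finType) (X : I -> {RV P >-> R}) :
  mutually_independent X ->
  mutually_independent (fun i => (- X i)%R : {RV P >-> R}).
Proof.
move=> indX J B mB.
have mN i : measurable (-%R @^-1` B i).
  by rewrite -[X in measurable X]setTI; exact: oppr_measurable.
exact: (indX J (fun i => -%R @^-1` B i) mN).
Qed.

Lemma max_abs_partial_sum_geE n (X : 'I_n -> {RV P >-> R}) (t : R) :
  [set w | exists2 j, (j <= n)%N & (t <= `|\sum_(i < n | (i < j)%N) X i w|)%R] =
  [set w | exists2 j, (j <= n)%N & (t <= \sum_(i < n | (i < j)%N) X i w)%R] `|`
  [set w | exists2 j, (j <= n)%N &
    (t <= \sum_(i < n | (i < j)%N) (- X i : {RV P >-> R})%R w)%R].
Proof.
have N j w : (\sum_(i < n | (i < j)%N) (- X i : {RV P >-> R})%R w =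
    - \sum_(i < n | (i < j)%N) X i w)%R by rewrite -sumrN.
apply/seteqP; split=> w /=.
  move=> [j jn]; rewrite ler_normr => /orP[tj|tj]; [left|right]; exists j => //.
  by rewrite N.
by move=> [[j jn]|[j jn]]; rewrite ?N => tj; exists j => //; rewrite ler_normr tj ?orbT.
Qed.

Lemma measurable_max_abs_partial_sum_ge n (X : 'I_n -> {RV P >-> R}) (t : R) :
  measurable
  [set w | exists2 j, (j <= n)%N & (t <= `|\sum_(i < n | (i < j)%N) X i w|)%R].
Proof.
by rewrite max_abs_partial_sum_geE; apply: measurableU;
  exact: measurable_max_partial_sum_ge.
Qed.

Lemma bernstein_maximal_abs v kappa n (X : 'I_n -> {RV P >-> R}) (t : R) :
  (0 < kappa)%R -> (0 < v)%R -> (0 < n)%N -> (0 < t)%R ->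
  mutually_independent X ->
  (forall i, 'E_P[X i] = 0) -> (forall i, bernstein_moments P v kappa (X i)) ->
  P [set w | exists2 j, (j <= n)%N & (t <= `|\sum_(i < n | (i < j)%N) X i w|)%R]
   <= (2 * expR (- (t ^+ 2 / (2 * (n%:R * v + kappa * t)))))%:E.
Proof.
move=> kappa0 v0 n0 t0 indX EX mom.
pose N i : {RV P >-> R} := (- X i)%R.
have EN i : 'E_P[N i] = 0.
  have intX := bernstein_integrable (mom i).
  transitivity (- 'E_P[X i]); last by rewrite EX oppe0.
  by rewrite !unlock -integralN//; exact: integrable_add_def.
have momN i : bernstein_moments P v kappa (N i).
  move=> m m2; apply: le_trans (mom i m m2).
  rewrite le_eqVlt; apply/orP; left; apply/eqP; congr expectation.
  by apply/funext => w; rewrite /N/= normrN.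
have H1 := bernstein_maximal kappa0 v0 n0 t0 indX EX mom.
have H2 := bernstein_maximal kappa0 v0 n0 t0 (mutually_independentN indX) EN momN.
rewrite max_abs_partial_sum_geE mulr_natl mulr2n EFinD.
apply: le_trans (leeD H1 H2); apply: measureU2;
  exact: measurable_max_partial_sum_ge.
Qed.

End bernstein_two_sided.

(** * Kolmogorov distance to functions with few modes *)

Section kolmogorov_distance.
Variable R : realType.
Implicit Types (f g h : R -> R).

Lemma Linfty_integrable f (x : R) : Linfty f -> x <= 1 ->
  leb.-integrable (`[0, x]%classic : set (lebesgueType R)) (EFin \o f).
Proof.
move=> [mf [M fM]] x1.
have sub : `[0, x]%classic `<=` (`[0, 1]%classic : set R).
  by move=> s /=; rewrite !in_itv/= => /andP[-> /le_trans]; apply.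
have mI : measurable (`[0, x]%classic : set (lebesgueType R)).
  exact: lebesgue_mitv.
have mfx : measurable_fun (`[0, x]%classic : set (lebesgueType R)) f.
  exact: (measurable_funS (lebesgue_mitv `[0, 1])).
apply/integrableP; split; first exact/measurable_EFinP.
(* The bound is taken as the absolute value of [M], since the sign of [M] is not part of the
   definition of [Linfty]. *)
have leM : (\int[leb]_(s in (`[0%R, x]%classic : set (lebesgueType R))) `|(EFin \o f) s| <=
    \int[leb]_(s in (`[0%R, x]%classic : set (lebesgueType R))) (cst `|M| s)%:E)%E.
  apply: ae_ge0_le_integral.
  - exact: mI.
  - by move=> s _; exact: abse_ge0.
  - exact/measurableT_comp/measurable_EFinP.
  - by move=> s _; rewrite /= lee_fin.
  - by apply/measurable_EFinP; exact: measurable_cst.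
  - case: fM => N [mN N0 fMN]; exists N; split=> // s /= nfs; apply: fMN => /= fsM.
    apply: nfs => sx; rewrite lee_fin (le_trans (fsM _)) ?ler_norm//.
    exact: sub.
rewrite (le_lt_trans leM)// (@integral_leb_cst _ `[0, x] _ `|M|)//.
rewrite lebesgue_measure_itv/=.
by case: ifP => _; rewrite ?mule0// -EFinB -EFinM ltry.
Qed.

Lemma Linfty_integrableB f g (x : R) : Linfty f -> Linfty g -> x <= 1 ->
  leb.-integrable (`[0, x]%classic : set (lebesgueType R))
    (EFin \o (fun s => f s - g s)).
Proof.
move=> Lf Lg x1.
have mI : measurable (`[0, x]%classic : set (lebesgueType R)).
  exact: lebesgue_mitv.
have := integrableB mI (Linfty_integrable Lf x1) (Linfty_integrable Lg x1).
by apply: eq_integrable => // s _; rewrite /= EFinB.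
Qed.

Lemma dK_triangle f g h : Linfty f -> Linfty g -> Linfty h ->
  (dK f h <= dK f g + dK g h)%E.
Proof.
move=> Lf Lg Lh; apply: ge_ereal_sup => _ [x x01 <-].
have x1 : x <= 1 by move: x01; rewrite /= in_itv/= => /andP[].
have E : \int[leb]_(s in `[0, x]) (f s - h s) =
    \int[leb]_(s in `[0, x]) (f s - g s) + \int[leb]_(s in `[0, x]) (g s - h s).
  rewrite -RintegralD; [|exact: lebesgue_mitv|exact: Linfty_integrableB..].
  by apply: eq_Rintegral => s _; rewrite addrA subrK.
rewrite E (@le_trans _ _ (`|\int[leb]_(s in `[0, x]) (f s - g s)|%:E +
  `|\int[leb]_(s in `[0, x]) (g s - h s)|%:E)%E)//.
  by rewrite -EFinD lee_fin ler_normD.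
by apply: leeD; apply: ereal_sup_ubound; exists x.
Qed.

Lemma step_Linfty n (y : 'I_n -> R) : (0 < n)%N -> Linfty (step y).
Proof. by move=> n0; have [[]] := step_PC y n0. Qed.

(** * Kolmogorov distance between step functions *)

Section integral_step.
Variables (n : nat) (n0 : (0 < n)%N) (y z : 'I_n -> R).
Let G x := \int[leb]_(s in `[0, x]) (step y s - step z s).

Lemma integral_step_cell (i : 'I_n) x :
  i%:R / n%:R <= x <= i.+1%:R / n%:R ->
  G x = G (i%:R / n%:R) + (x - i%:R / n%:R) * (y i - z i).
Proof.
move=> /andP[]; rewrite le_eqVlt => /predU1P[<- _|ix xi].
  by rewrite subrr mul0r addr0.
have i0 : 0 <= i%:R / n%:R :> R by rewrite divr_ge0.
have x1 : x <= 1.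
  by rewrite (le_trans xi)// ler_pdivrMr ?ltr0n// mul1r ler_nat.
(* The point [x] is split off as a null set: if it is the right end of the cell, the step functions
   need not take the values [y i] and [z i] there. *)
have E : `[0, x]%classic = `[0, i%:R / n%:R]%classic `|`
    (`]i%:R / n%:R, x[%classic `|` `[x, x]%classic) :> set R.
  rewrite -itv_bndbnd_setU ?bnd_simp ?ltW// -itv_bndbnd_setU ?bnd_simp//.
  by rewrite ltW.
have intG : leb.-integrable (`[0, x]%classic : set (lebesgueType R))
    (EFin \o (fun s => step y s - step z s)).
  by apply: Linfty_integrableB => //; exact: step_Linfty.
rewrite /G E Rintegral_setU//=; last 4 first.
- exact: lebesgue_mitv.
- by apply: measurableU; exact: lebesgue_mitv.
- by rewrite -E.
- apply/disj_setPS => s [/=]; rewrite !in_itv/= => /andP[_ si].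
  case=> /andP[h _]; first by rewrite ltNge si in h.
  by rewrite leNgt (le_lt_trans si ix) in h.
congr (_ + _).
rewrite /Rintegral integral_setU//=; last 4 first.
- exact: lebesgue_mitv.
- exact: lebesgue_mitv.
- apply: (measurable_funS (lebesgue_mitv `[0, x]) _ (measurable_int _ intG)).
  by rewrite E; exact: subsetUr.
- apply/disj_setPS => s [/=]; rewrite !in_itv/= => /andP[_ sx] /andP[xs _].
  by rewrite ltNge xs in sx.
rewrite (@integral_leb_cst _ `]i%:R / n%:R, x[ _ (y i - z i)); last first.
  move=> s; rewrite in_itv/= => /andP[s1 s2].
  by rewrite !(stepE _ (i := i)) ?s1 ?(lt_le_trans s2).
rewrite (@integral_leb_cst _ `[x, x] _ (step y x - step z x)); last first.
  by move=> s; rewrite in_itv/= -eq_le => /eqP ->.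
rewrite !lebesgue_measure_itv/= !lte_fin ltxx ix mule0 adde0.
by rewrite -EFinB -EFinM/= mulrC.
Qed.

Lemma integral_step_grid m : (m <= n)%N ->
  G (m%:R / n%:R) = (\sum_(i < n | (i < m)%N) (y i - z i)) / n%:R.
Proof.
elim: m => [_|m IH mn].
  rewrite big_pred0// !mul0r /G /Rintegral.
  rewrite (@integral_leb_cst _ `[0, 0] _ (step y 0 - step z 0)).
    by rewrite lebesgue_measure_itv/= ltxx mule0.
  by move=> s; rewrite in_itv/= -eq_le => /eqP ->.
have mm : (m%:R / n%:R <= m.+1%:R / n%:R :> R) && (m.+1%:R / n%:R <= m.+1%:R / n%:R :> R).
  by rewrite lexx andbT ler_pM2r ?invr_gt0 ?ltr0n// ler_nat.
rewrite (@integral_step_cell (Ordinal mn))//= IH ?(ltnW mn)//.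
have -> : m.+1%:R / n%:R - m%:R / n%:R = n%:R^-1 :> R.
  by rewrite -mulrBl -natr1 addrAC subrr add0r mul1r.
rewrite [in RHS](bigD1 (Ordinal mn))//= addrC mulrDl [n%:R^-1 * _]mulrC.
congr (_ / _ + _); apply: eq_bigl => i.
by rewrite ltnS -val_eqE/= ltn_neqAle andbC.
Qed.

(** The integral [G] is affine on each cell, so a bound on its absolute value at the grid points,
    where it is a partial sum divided by [n], holds everywhere. *)
Lemma dK_step_le (c : R) :
  (forall m, (m <= n)%N ->
    `|\sum_(i < n | (i < m)%N) (y i - z i)| <= c * n%:R) ->
  (dK (step y) (step z) <= c%:E)%E.
Proof.
move=> H.
have n0R : 0 < n%:R :> R by rewrite ltr0n.
have HG m : (m <= n)%N -> `|G (m%:R / n%:R)| <= c.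
  move=> mn; rewrite integral_step_grid// normrM normfV (gtr0_norm n0R).
  by rewrite ler_pdivrMr//; exact: H.
apply: ge_ereal_sup => _ [x /= x01 <-]; rewrite lee_fin -/(G x).
have [[i /andP[ix xi]]|[k kn ->]] := grid_or_cell n0 x01; last exact: HG.
have Ei := @integral_step_cell i x; rewrite !ltW//= in Ei.
have := @integral_step_cell i (i.+1%:R / n%:R).
rewrite lexx andbT (ltW (lt_trans ix xi)) => /(_ isT) Ei1.
have := HG _ (ltn_ord i); have := HG _ (ltnW (ltn_ord i)).
rewrite (Ei isT) Ei1; move: ix xi.
set a := i%:R / n%:R; set b := i.+1%:R / n%:R; set g := G a; set u := y i - z i.
move=> ax xb; rewrite !ler_norml => /andP[g1 g2] /andP[g3 g4].
by apply/andP; split; nra.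
Qed.

(** A crude bound: it provides the Lipschitz estimate behind measurability and does not enter the
    probability bound. *)
Lemma dK_step_sum : (dK (step y) (step z) <= (\sum_i `|y i - z i|)%:E)%E.
Proof.
apply: dK_step_le => m mn.
rewrite (le_trans (ler_norm_sum _ _ _))//.
rewrite (@le_trans _ _ (\sum_i `|y i - z i|))//.
  by rewrite [leRHS](bigID (fun i : 'I_n => (i < m)%N))/= lerDl sumr_ge0.
by rewrite ler_peMr ?sumr_ge0// ler1n.
Qed.

End integral_step.

End kolmogorov_distance.

Local Arguments s_ : simpl never.

(** * Distance to functions with few modes, and its measurability *)

Section distance_to_modal.
Variables (R : realType) (n : nat) (n0 : (0 < n)%N).
Implicit Types (y z : 'I_n -> R) (g h : R -> R) (j : nat) (eta : R).

Lemma modalX_Linfty j h : modalX n j h -> Linfty h.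
Proof. by case=> -[[]]. Qed.

Lemma le_s_ j g : (s_ n j.+1%:Z g <= s_ n j%:Z g)%E.
Proof.
apply: ereal_inf_le_tmp => _ [h [hPC hj] <-]; exists h => //; split=> //.
by rewrite (le_trans hj)// lee_fin ler_nat.
Qed.

Lemma s_step_lip j y z :
  (s_ n j%:Z (step y) <= s_ n j%:Z (step z) + (\sum_i `|y i - z i|)%:E)%E.
Proof.
rewrite addeC -leeBlDl//; apply: le_ereal_inf_tmp => _ [h hX <-].
rewrite leeBlDl//.
apply: (@le_trans _ _ (dK (step y) h)); first by apply: ereal_inf_lbound; exists h.
apply: (@le_trans _ _ (dK (step y) (step z) + dK (step z) h)%E).
  by apply: dK_triangle; [exact: step_Linfty..|exact: modalX_Linfty hX].
by apply: leeD => //; exact: dK_step_sum.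
Qed.

(** Excludes the value [-oo] when [s_] is analysed by cases; the point 0 shows that the supremum in
    [dK] is over a nonempty set of absolute values. *)
Lemma s_ge0 j g : (0 <= s_ n j%:Z g)%E.
Proof.
apply: le_ereal_inf_tmp => _ [h _ <-].
apply: (@le_trans _ _ `|\int[leb]_(s in `[0, 0]) (g s - h s)|%:E).
  by rewrite lee_fin.
by apply: ereal_sup_ubound; exists 0 => //=; rewrite in_itv/= lexx ler01.
Qed.

(** As [s_] is nonincreasing in its index, [kset] is an initial segment of the naturals. So [j] is
    its maximum exactly when it contains [j] but not its successor. *)
Lemma k_eqP eta g j : 0 < eta -> PC n g ->
  k_ n eta g = j <-> (eta%:E <= s_ n (j%:Z - 1) g)%E /\ (s_ n j%:Z g < eta%:E)%E.
Proof.
move=> eta0 gPC; have [K U] := k_etaP n0 eta0 gPC.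
have ksetS i : kset n eta g i.+1 <-> (eta%:E <= s_ n i%:Z g)%E.
  by rewrite /kset /mkset (_ : i.+1%:Z - 1 = i%:Z)//; lia.
have down i m : (i <= m)%N -> kset n eta g m -> kset n eta g i.
  elim: m => [|m IH]; first by rewrite leqn0 => /eqP ->.
  rewrite leq_eqVlt => /predU1P[->//|im] /ksetS h; apply: IH => //.
  case: m {im} h => [_|m h]; first by rewrite /kset/= leey.
  by apply/ksetS; rewrite (le_trans h)// le_s_.
split=> [<-|[kj sj]].
  split=> //; rewrite ltNge; apply/negP => /ksetS /U; lia.
have jk' : (j <= k_ n eta g)%N := U j kj.
apply/eqP; rewrite eqn_leq jk' andbT leqNgt; apply/negP => jk.
by have /ksetS := down _ _ jk K; rewrite leNgt sj.
Qed.

(** By the Lipschitz bound, the set is a countable union over rational vectors [q r]: the distance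
    at [q r] plus the deviation [D r w] of the cell values from [q r] must stay below [eta]. Only
    [D r] depends on [w]. *)
Lemma measurable_s_lt d (T : measurableType d) (Y : 'I_n -> T -> R) j eta :
  (forall i, measurable_fun setT (Y i)) ->
  measurable [set w | (s_ n j%:Z (step (fun i => Y i w)) < eta%:E)%E].
Proof.
move=> mY; pose q (r : {ffun 'I_n -> rat}) (i : 'I_n) : R := ratr (r i).
pose D r w : R := \sum_i `|Y i w - q r i|.
have mD r : measurable_fun setT (D r).
  apply: measurable_sum => i; apply: measurableT_comp => //.
  by apply: measurable_funB.
rewrite (_ : [set w | _] = \bigcup_r
    [set w | (s_ n j%:Z (step (q r)) + (D r w)%:E < eta%:E)%E]); last first.
  apply/seteqP; split => w /=.
    move=> sw.
    have [e e0 se] : exists2 e, 0 < e &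
        (s_ n j%:Z (step (fun i => Y i w)) + e%:E < eta%:E)%E.
      move: sw (s_ge0 j (step (fun i => Y i w))).
      case: (s_ _ _ _) => [s| |]; [|by rewrite ltNge leey|by []].
      rewrite lte_fin => sw _.
      by exists ((eta - s) / 2); rewrite ?lte_fin; lra.
    (* The deviation [D] is counted twice, once in passing from [Y] to the rational vector and once
       in the defining inequality, so it may be at most [e / 2] over all [n] cells. *)
    have e_n : 0 < e / 2 / n%:R by rewrite !divr_gt0// ltr0n.
    have /choice[r rP] : forall i, exists r : rat, `|Y i w - ratr r| < e / 2 / n%:R.
      move=> i; have [r] : exists r, ratr r \in `]Y i w - e / 2 / n%:R, Y i w[.
        by apply: rat_in_itvoo; lra.
      by rewrite in_itv/= => /andP[r1 r2]; exists r; rewrite ltr_norml; lra.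
    exists (finfun r) => //=.
    have De : D (finfun r) w <= e / 2.
      rewrite /D (@le_trans _ _ (\sum_(i < n) (e / 2 / n%:R)))//.
        by apply: ler_sum => i _; rewrite /q ffunE ltW.
      rewrite sumr_const card_ord -[leLHS]mulr_natr divfK//.
      by rewrite pnatr_eq0 -lt0n.
    apply: le_lt_trans se.
    have := s_step_lip j (q (finfun r)) (fun i => Y i w).
    rewrite (_ : \sum_i `|_| = D (finfun r) w); last first.
      by apply: eq_bigr => i _; rewrite distrC.
    move=> h; apply: (@le_trans _ _ (s_ n j%:Z (step (fun i => Y i w)) +
       (D (finfun r) w)%:E + (D (finfun r) w)%:E)%E); first exact: leeD.
    by rewrite -addeA leeD// -EFinD lee_fin; lra.
  move=> [r _ /=]; apply: le_lt_trans.
  exact: (s_step_lip j (fun i => Y i w) (q r)).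
apply: countable_bigcupT_measurable; first exact: countableP.
move=> r; move: (s_ge0 j (step (q r))); case: (s_ _ _ _) => [s| |] // _.
- rewrite (_ : [set w | _] = (D r) @^-1` `]-oo, eta - s[).
    by rewrite -[X in measurable X]setTI; exact: mD.
  apply/seteqP; split => w /=; rewrite in_itv/= -EFinD lte_fin; lra.
- rewrite (_ : [set w | _] = set0)//.
  by apply/seteqP; split => w.
Qed.

End distance_to_modal.

(** * Probability of recovering the number of modes *)

Theorem theorem5 (R : realType) (d : measure_display) (T : measurableType d)
  (P : probability T R)
  (X : set (R -> R)) (hX : X `<=` @calL R) (f : R -> R) (hf : X f)
  (n : nat) (hn : (1 <= n)%N)
  (epsilon_ : 'I_n -> {RV P >-> R})
  (hindep : mutually_independent epsilon_)
  (hmean : forall i, ('E_P[epsilon_ i] = 0)%E)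
  (kappa v : R) (hkappa : 0 < kappa) (hv : 0 < v)
  (hmoment : forall (i : 'I_n) (m : nat), (2 <= m)%N ->
    ('E_P[fun w => (`|epsilon_ i w| ^+ m)%R]
       <= (v * m`!%:R * kappa ^+ (m - 2) / 2)%:E)%E)
  (eps : R) (heps : 0 < eps) (k : nat) :
  let fn : R -> R := step (fun i : 'I_n => f (i%:R / n%:R)) in
  let Y (i : 'I_n) (w : T) : R := f (i%:R / n%:R) + epsilon_ i w in
  let Yn (w : T) : R -> R := step (fun i : 'I_n => Y i w) in
  let E : set T := [set w | k_ n (eps / 2) (Yn w) = k] in
  modalX n k fn ->
  (eps%:E <= s_ n (k%:Z - 1) fn)%E ->
  measurable E /\
  ((1 - 2 * expR (- (eps ^+ 2 * n%:R / (8 * v + 4 * kappa * eps))))%:E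
     <= P E)%E.
Proof.
move=> fn Y Yn E fnk sfn.
have eta0 : 0 < eps / 2 by rewrite divr_gt0.
have n0R : 0 < n%:R :> R by rewrite ltr0n.
have mY i : measurable_fun setT (Y i).
  by apply: measurable_funD; [exact: measurable_cst|exact: measurable_funPT].
have EE : E = [set w | (s_ n k%:Z (Yn w) < (eps / 2)%:E)%E] `&`
    ~` [set w | (s_ n (k%:Z - 1) (Yn w) < (eps / 2)%:E)%E].
  apply/seteqP; split => w; rewrite /E /=.
    move=> /(k_eqP hn k eta0 (step_PC _ hn)) [h1 h2]; split=> //.
    by apply/negP; rewrite -leNgt.
  move=> [h1 /negP]; rewrite -leNgt => h2.
  by apply/(k_eqP hn k eta0 (step_PC _ hn)).
have mE : measurable E.
  rewrite EE; apply: measurableI; first exact: measurable_s_lt.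
  (* For [k] equal to 0 the index is -1, where [s_] is [+oo] and the set is empty. *)
  apply: measurableC; case: (k) => [|j].
    by rewrite (_ : [set w | _] = set0)//; apply/seteqP; split.
  by rewrite intS addrAC subrr add0r; exact: measurable_s_lt.
split=> //.
(* The distance between step functions is a maximal partial sum divided by [n], so the distance
   [eps / 2] corresponds to this threshold. *)
set t := n%:R * (eps / 2).
have t0 : 0 < t by exact: mulr_gt0.
pose B := [set w | exists2 j, (j <= n)%N &
   t <= `|\sum_(i < n | (i < j)%N) epsilon_ i w|].
have mB : measurable B by exact: measurable_max_abs_partial_sum_ge.
have PB : (P B <= (2 * expR (- (eps ^+ 2 * n%:R / (8 * v + 4 * kappa * eps))))%:E)%E.
  apply: le_trans (bernstein_maximal_abs hkappa hv hn t0 hindep hmean hmoment) _.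
  rewrite lee_fin le_eqVlt; apply/orP; left; apply/eqP.
  do 3 congr (_ _); rewrite /t; field.
  by rewrite !gt_eqF// ?addr_gt0// !mulr_gt0.
have BE : ~` B `<=` E.
  move=> w Bw; apply/(k_eqP hn k eta0 (step_PC _ hn)).
  (* A maximum of finitely many values below [t] stays strictly below [t]. This yields the strict
     inequality [c < eps / 2] needed for [s_ n k%:Z (Yn w) < (eps / 2)%:E]. *)
  pose c := (\big[Num.max/0]_(j < n.+1)
     `|\sum_(i < n | (i < j)%N) epsilon_ i w|) / n%:R.
  have ceta : c < eps / 2.
    rewrite /c ltr_pdivrMr// mulrC -/t; apply/bigmax_ltP; split=> // j _.
    by rewrite ltNge; apply/negP => tj; apply: Bw; exists j; rewrite // -ltnS.
  have cS m : (m <= n)%N -> `|\sum_(i < n | (i < m)%N) epsilon_ i w| <= c * n%:R.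
    move=> mn; rewrite /c divfK ?gt_eqF//.
    have mn' : (m < n.+1)%N by [].
    exact: (le_bigmax _ (fun j : 'I_n.+1 => `|\sum_(i < n | (i < j)%N) epsilon_ i w|)
      (Ordinal mn')).
  have d1 : (dK (Yn w) fn <= c%:E)%E.
    apply: dK_step_le => // m mn; rewrite (le_trans _ (cS m mn))//.
    by rewrite (eq_bigr (fun i => epsilon_ i w))// => i _; rewrite /Y addrAC subrr add0r.
  have d2 : (dK fn (Yn w) <= c%:E)%E.
    apply: dK_step_le => // m mn; rewrite (le_trans _ (cS m mn))//.
    rewrite -normrN -sumrN (eq_bigr (fun i => epsilon_ i w))// => i _.
    by rewrite /Y opprB addrAC subrr add0r.
  split; last first.
    apply: (@le_lt_trans _ _ (dK (Yn w) fn)); first by apply: ereal_inf_lbound; exists fn.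
    by rewrite (le_lt_trans d1)// lte_fin.
  case: (k) sfn => [_|j]; first exact: leey.
  rewrite intS addrAC subrr add0r.
  (* Any [h] with at most [j] modes has distance at least [eps] from [fn], hence at least [eps - c],
     which exceeds [eps / 2], from [Yn w]. *)
  move=> sfn; apply: le_ereal_inf_tmp => _ [h hX' <-].
  have h1 : (eps%:E <= dK fn h)%E.
    by apply: le_trans sfn _; apply: ereal_inf_lbound; exists h.
  have h2 : (dK fn h <= dK fn (Yn w) + dK (Yn w) h)%E.
    by apply: dK_triangle; [exact: step_Linfty..|exact: modalX_Linfty hX'].
  have h3 : (eps%:E <= c%:E + dK (Yn w) h)%E.
    by apply: (le_trans h1); apply: (le_trans h2); exact: leeD.
  move: h3; rewrite -leeBlDl// => h3; apply: le_trans h3.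
  by rewrite -EFinB lee_fin; lra.
apply: (@le_trans _ _ (P (~` B))); last first.
  by apply: le_measure; rewrite ?inE//; exact: measurableC.
rewrite probability_setC// EFinB; exact: leeB.
Qed.
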